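(* Let $d\ge1$, $\theta^*\in\mathbb{R}^d$, $\Sigma_x\in\mathbb{R}^{d\times d}$ positive definite, $\sigma_\epsilon>0$. Let $x\sim\mathcal{N}(0,\Sigma_x)$ and $y=\theta^{*\top}x+\epsilon$, where $\epsilon$ is independent of $x$ with $\mathbb{E}[\epsilon]=0$ and $\mathbb{E}[\epsilon^2]=\sigma_\epsilon^2$. For the squared loss $\ell(\theta;(x,y))=\frac12(y-\theta^\top x)^2$, let $\mu_g(\theta)$ and $\Sigma_g(\theta)$ be the mean and covariance of $\nabla_\theta\ell(\theta;(x,y))$. Let $(x^*,y^* )\in\mathbb{R}^d\times\mathbb{R}$ be a target point with residual $\epsilon^*=y^*-\theta^{*\top}x^*$, let $\delta_g=\nabla_\theta\ell(\theta^*;(x^*,y^* ))-\mu_g(\theta^* )$ and $m^*=\delta_g^\top\Sigma_g(\theta^* )^{-1}\delta_g$. Then \[ m^*=\frac{(\epsilon^* )^2}{\sigma_\epsilon^2}\,(x^* )^\top\Sigma_x^{-1}x^*. \] *)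

(* Defs.v *)
From HB Require Import structures.
From mathcomp Require Import all_boot all_order all_algebra.
From mathcomp Require Import all_classical all_reals all_analysis.
Set Implicit Arguments. Unset Strict Implicit. Unset Printing Implicit Defensive.
Import Order.TTheory GRing.Theory Num.Theory.
Import numFieldNormedType.Exports.
Local Open Scope classical_set_scope.
Local Open Scope ring_scope.

Section Defs.
Context {R : realType}.

Definition posdef {n : nat} (S : 'M[R]_n) : Prop :=
  S^T = S /\ forall v : 'cV[R]_n, v != 0 -> 0 < (v^T *m S *m v) 0 0.

Definition sqloss {n : nat} (theta x : 'cV[R]_n) (y : R) : R :=
  2^-1 * (y - (theta^T *m x) 0 0) ^+ 2.

Definition grad {n : nat} (f : 'cV[R]_n -> R) (theta : 'cV[R]_n) : 'cV[R]_n :=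
  \col_i ('D_1 (fun t : R => f (theta + t *: delta_mx i 0)) 0 : R).

Context {d : measure_display} {T : measurableType d} (P : probability T R).

Definition Ex (f : T -> R) : R := fine (\int[P]_w (f w)%:E)%E.

Definition meanv {n : nat} (G : T -> 'cV[R]_n) : 'cV[R]_n :=
  \col_i Ex (fun w => G w i 0).

Definition covm {n : nat} (G : T -> 'cV[R]_n) : 'M[R]_n :=
  \matrix_(i, j) Ex (fun w => (G w i 0 - meanv G i 0) * (G w j 0 - meanv G j 0)).

(* X ~ N(0, S): every nonzero linear functional a^T X is N(0, a^T S a)
   (Cramer-Wold characterisation; normal_prob m s takes the std. deviation s) *)
Definition centered_gaussian {n : nat} (X : T -> 'cV[R]_n) (S : 'M[R]_n) : Prop :=
  (forall i, measurable_fun setT (fun w => X w i 0)) /\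
  forall a : 'cV[R]_n, a != 0 -> forall A : set R, measurable A ->
    P [set w | (a^T *m X w) 0 0 \in A] =
    normal_prob 0 (Num.sqrt ((a^T *m S *m a) 0 0)) A.

Definition indep_vec_rv {n : nat} (X : T -> 'cV[R]_n) (e : T -> R) : Prop :=
  forall (A : 'I_n -> set R) (B : set R),
    (forall i, measurable (A i)) -> measurable B ->
    P ([set w | forall i, X w i ord0 \in A i] `&` (e @^-1` B)) =
    (P [set w | forall i, X w i ord0 \in A i] * P (e @^-1` B))%E.

End Defs.

(* Main.v *)
Require Import Defs.
From HB Require Import structures.
From mathcomp Require Import all_boot all_order all_algebra.
From mathcomp Require Import all_classical all_reals all_analysis.
From mathcomp Require Import measurable_realfun ring lra.
Import Order.TTheory GRing.Theory Num.Theory.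
Import numFieldNormedType.Exports.
Local Open Scope classical_set_scope.
Local Open Scope ring_scope.

(** At the true parameter the gradient of the loss is [- eps * x].  Since [eps]
    is centered and independent of [x], it has mean [0] and covariance
    [E[eps^2] * E[x x^T] = sig^2 * Sx], so the Mahalanobis norm of the target
    gradient [- eps_s * xs] is [eps_s^2 / sig^2 * xs^T Sx^-1 xs].

    The second moments [E[x_i x_j]] are obtained by polarization from those of
    the one-dimensional normal laws of [a^T x]; the second moment of a normal law
    comes from the antiderivative [- s^2 x p(x)] of [(x^2 - s^2) p(x)].
    Independence of [(x_i, x_j)] and [eps] follows from the box form by uniqueness
    of measures, and products of expectations from Fubini's theorem. *)

(** * Gradient of the squared loss *)

Lemma grad_sqloss {R : realType} {n : nat} (theta x : 'cV[R]_n) (y : R) :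
  grad (fun th => sqloss th x y) theta = - (y - (theta^T *m x) 0 0) *: x.
Proof.
apply/matrixP => i j; rewrite !mxE ord1.
have -> : \sum_j theta^T 0 j * x j 0 = (theta^T *m x) 0 0 by rewrite mxE.
set c := y - (theta^T *m x) 0 0.
(* Moving [theta] by [t] along the [i]-th basis vector lowers the residual [c] by [t * x i 0], so
   only a quadratic in [t] has to be differentiated. *)
have -> : (fun t : R => sqloss (theta + t *: delta_mx i 0) x y) =
    (fun t : R => 2^-1 * (c - t * x i 0) ^+ 2).
  apply/funext => t; rewrite /sqloss /c; congr (_ * _ ^+ 2).
  rewrite linearD linearZ/= mulmxDl -scalemxAl trmx_delta -rowE [in LHS]mxE.
  by rewrite opprD addrA !mxE.
have : is_derive (0 : R) (1 : R)
    (fun t : R => 2^-1 * (c - t * x i 0) ^+ 2) (- c * x i 0).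
  have -> : (fun t : R => 2^-1 * (c - t * x i 0) ^+ 2) =
      cst 2^-1 * (cst c - id * cst (x i 0)) ^+ 2 by [].
  apply: is_derive_eq.
  rewrite !fctE /GRing.scale/= !mul0r subr0 /cst; lra.
by move=> ?; rewrite derive_val.
Qed.

(** * Second moment of a centered normal law *)

Section normal_second_moment.
Context {R : realType}.
Notation mu := (@lebesgue_measure R).
Implicit Types s x : R.

Lemma is_derive_normal_pdf s x : s != 0 ->
  is_derive x (1 : R) (normal_pdf 0 s) (- (x / s ^+ 2) * normal_pdf 0 s x).
Proof.
move=> s0; rewrite normal_pdfE//.
have -> : (fun x => normal_peak s * normal_fun 0 s x) =
    cst (normal_peak s) * (expR \o (- (id ^+ 2) * cst (s ^+ 2 *+ 2)^-1)).
  by apply/funext => t; rewrite /normal_fun subr0.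
apply: is_derive_eq.
rewrite !fctE /GRing.scale/= /cst /normal_fun subr0.
by field; rewrite s0.
Qed.

(** With [u = x^2 / (2 s^2)], the bound [u <= 1 + u <= exp u] gives [x * exp (- u) <= 2 s^2 / x], so
    the product is squeezed between 0 and [K / x]. *)
Lemma cvg_mul_normal_pdf s : s != 0 ->
  x * normal_pdf 0 s x @[x --> +oo] --> (0 : R).
Proof.
move=> s0.
set K := normal_peak s * (s ^+ 2 *+ 2).
have K0 : 0 < K.
  by rewrite mulr_gt0 ?normal_peak_gt0// mulrn_wgt0// exprn_even_gt0.
apply: (@squeeze_cvgr _ _ _ _ (cst 0) (fun x => K * x^-1)).
- near=> x.
  have x0 : 0 < x by near: x; exact: nbhs_pinfty_gt.
  rewrite /= (mulr_ge0 (ltW x0) (normal_pdf_ge0 _ _ _))/=.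
  rewrite normal_pdfE// /normal_fun subr0.

  rewrite /K [leLHS]mulrCA -[leRHS]mulrA ler_wpM2l ?normal_peak_ge0//.
  rewrite mulNr expRN ler_pdivlMr// mulrAC -expr2 ler_pdivrMr ?expR_gt0//.
  have q0 : 0 < s ^+ 2 *+ 2 by rewrite mulrn_wgt0// exprn_even_gt0.
  rewrite -ler_pdivrMl// mulrC (le_trans _ (expR_ge1Dx _))//.
  by rewrite lerDr.
- exact: cvg_cst.
- rewrite -[X in _ --> X](mulr0 K); apply: cvgM; first exact: cvg_cst.
  apply/gtr0_cvgV0; last exact: cvg_id.
  exact: nbhs_pinfty_gt.
Unshelve. all: by end_near. Qed.

(** Change of variables brings in the abstract Radon-Nikodym derivative. It equals [normal_pdf]
    almost everywhere because both have the same integral over every measurable set. *)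
Lemma ge0_integral_normal_prob m s (f : R -> \bar R) :
  measurable_fun setT f -> (forall x, 0 <= f x)%E ->
  (\int[normal_prob m s]_x f x = \int[mu]_x (f x * (normal_pdf m s x)%:E))%E.
Proof.
move=> mf f0.
have dom := normal_prob_dominates m s.
rewrite -(Radon_Nikodym_SigmaFinite.change_of_variables dom)//.
have RNi := Radon_Nikodym_SigmaFinite.f_integrable dom.
have mpdf : measurable_fun setT (fun x => (normal_pdf m s x)%:E).
  by apply/measurable_EFinP; exact: measurable_normal_pdf.
apply: ae_eq_integral => //.
- by apply: emeasurable_funM => //; exact: measurable_int RNi.
- exact: emeasurable_funM.
- apply: ae_eqe_mul2l; apply: integral_ae_eq => // A _ mA.
  by rewrite -Radon_Nikodym_SigmaFinite.f_integral.
Qed.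

(** The function [(x^2 - s^2) p(x)] integrates to 0 over the half-line: its antiderivative vanishes
    at 0 and at infinity, and the values at the cut point [s] cancel. *)
Lemma integral0y_sqr_normal_pdf s : 0 < s ->
  (\int[mu]_(x in `[0%R, +oo[) (x ^+ 2 * normal_pdf 0 s x)%:E =
   (s ^+ 2)%:E * \int[mu]_(x in `[0%R, +oo[) (normal_pdf 0 s x)%:E)%E.
Proof.
move=> s_gt0; have s0 : s != 0 by rewrite gt_eqF.
pose p : R -> R := normal_pdf 0 s.
have cp : continuous p by exact: continuous_normal_pdf.
have p0 x : 0 <= p x by exact: normal_pdf_ge0.
have csq : continuous (fun x : R => x ^+ 2) by exact: exprn_continuous.
pose f x := (x ^+ 2 - s ^+ 2) * p x.
(* F is an antiderivative of f; splitting at s makes f nonnegative on the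
   unbounded part, as the improper integral requires. *)
pose F x := - s ^+ 2 * (x * p x).
have F' x : is_derive x (1 : R) F (f x).
  have -> : F = cst (- s ^+ 2) * (id * p) by [].
  have := @is_derive_normal_pdf s x s0; rewrite -/p => ?.
  apply: is_derive_eq; rewrite !fctE /GRing.scale/= /cst /f.
  by field.
have cF : continuous F.
  by move=> x; apply/differentiable_continuous/derivable1_diffP; case: (F' x).
have cf : continuous f.
  move=> x; apply: cvgM; last exact: cp.
  by apply: cvgB; [exact: csq|exact: cvg_cst].
have ch : continuous (fun x => x ^+ 2 * p x).
  by move=> x; apply: cvgM; [exact: csq|exact: cp].
have F'f : derive1 F = f.
  by apply/funext => x; rewrite derive1E; have := F' x => ?; rewrite derive_val.
have mp : measurable_fun setT (EFin \o p).
  by apply/measurable_EFinP; exact: continuous_measurable_fun.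
have mf : measurable_fun setT (EFin \o f).
  by apply/measurable_EFinP; exact: continuous_measurable_fun.
have mh : measurable_fun setT (fun x => (x ^+ 2 * p x)%:E).
  by apply/measurable_EFinP; exact: continuous_measurable_fun.
have splitE (g : R -> R) : measurable_fun setT (EFin \o g) ->
    (forall x, 0 <= g x) ->
    (\int[mu]_(x in `[0%R, +oo[) (g x)%:E =
     \int[mu]_(x in `[0%R, s]) (g x)%:E + \int[mu]_(x in `[s, +oo[) (g x)%:E)%E.
  (* The two closed pieces share the null point [s]; opening the second one there makes them
     disjoint. *)
  move=> mg g0; rewrite -[X in (_ = _ + X)%E]integral_itv_obnd_cbnd; last first.
    exact: measurable_funTS.
  rewrite -ge0_integral_setU//=; last 3 first.
  - exact: measurable_funTS.
  - by move=> x _; rewrite lee_fin.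
  - apply/disj_setPS => x [/=]; rewrite !in_itv/= => /andP[_ xs].
    by rewrite andbT ltNge xs.
  by rewrite -itv_bndbnd_setU// bnd_simp// ltW.
have Ip (A : set R) : measurable A -> mu.-integrable A (EFin \o p).
  move=> mA; apply: (integrableS measurableT) => //.
  exact: integrable_normal_pdf.
have I1 : (\int[mu]_(x in `[0%R, s]) (x ^+ 2 * p x)%:E =
    (F s)%:E + (s ^+ 2)%:E * \int[mu]_(x in `[0%R, s]) (p x)%:E)%E.
  transitivity (\int[mu]_(x in `[0%R, s]) ((f x)%:E + (s ^+ 2)%:E * (p x)%:E))%E.
    by apply: eq_integral => x _; rewrite -EFinM -EFinD /f; congr EFin; ring.
  rewrite integralD//=; last 2 first.
  - apply: continuous_compact_integrable; first exact: segment_compact.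
    exact: continuous_subspaceT.
  - by apply: integrableZl => //; exact: Ip.
  rewrite integralZl//; last exact: Ip.
  congr (_ + _)%E.
  rewrite (@continuous_FTC2 _ f F)//; first by rewrite /F mul0r mulr0 sube0.
  - exact: continuous_subspaceT.
  - split; first by move=> x _; case: (F' x).
    + exact/cvg_at_right_filter/cF.
    + exact/cvg_at_left_filter/cF.
  - by move=> x _; rewrite F'f.
have I2 : (\int[mu]_(x in `[s, +oo[) (x ^+ 2 * p x)%:E =
    - (F s)%:E + (s ^+ 2)%:E * \int[mu]_(x in `[s, +oo[) (p x)%:E)%E.
  have f0 x : s <= x -> 0 <= f x.
    move=> sx; rewrite mulr_ge0// subr_ge0 lerXn2r// nnegrE ltW//.
    exact: lt_le_trans sx.
  transitivity (\int[mu]_(x in `[s, +oo[) ((f x)%:E + (s ^+ 2)%:E * (p x)%:E))%E.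
    by apply: eq_integral => x _; rewrite -EFinM -EFinD /f; congr EFin; ring.
  rewrite ge0_integralD//=; last 4 first.
  - by move=> x; rewrite in_itv/= andbT lee_fin; exact: f0.
  - exact: measurable_funTS.
  - by move=> x _; rewrite -EFinM lee_fin mulr_ge0// sqr_ge0.
  - by apply: measurable_funeM; exact: measurable_funTS.
  rewrite integralZl//; last exact: Ip.
  congr (_ + _)%E.
  rewrite (@ge0_continuous_FTC2y _ f F _ 0)//; first by rewrite sub0e.
  - exact: continuous_subspaceT.
  - rewrite -[X in _ --> X](mulr0 (- s ^+ 2)).
    by apply: cvgM; [exact: cvg_cst|exact: cvg_mul_normal_pdf].
  - exact/cvg_at_right_filter/cF.
  - by move=> x _; rewrite F'f.
rewrite (splitE (fun x => x ^+ 2 * p x))//; last first.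
  by move=> x; rewrite mulr_ge0// sqr_ge0.
have pge0 (A : set R) : (0 <= \int[mu]_(x in A) (p x)%:E)%E.
  by apply: integral_ge0 => x _; rewrite lee_fin.
rewrite I1 I2 (splitE p)//.
(* Nonnegativity of both integrals justifies distributing [s ^+ 2] over their sum in the extended
   reals. *)
move: (pge0 [set` `[0, s]]) (pge0 [set` `[s, +oo[]).
move: (integral _ _ _) (integral _ _ _) => v u u0 v0.
by rewrite ge0_muleDr// addeACA -EFinN -EFinD subrr add0e.
Qed.

(** Both [p(x)] and [x^2 p(x)] are even, so the half-line identity doubles to the whole line, where
    the density has integral 1. *)
Lemma normal_prob_second_moment s : 0 < s ->
  (\int[normal_prob 0 s]_x (x ^+ 2)%:E = (s ^+ 2)%:E)%E.
Proof.
move=> s_gt0; have s0 : s != 0 by rewrite gt_eqF.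
have symp : normal_pdf 0 s =1 normal_pdf 0 s \o -%R.
  by move=> x; rewrite /= !normal_pdfE// /normal_fun !subr0 sqrrN.
rewrite ge0_integral_normal_prob//; last 2 first.
- exact/measurable_EFinP/measurable_funX.
- by move=> x; rewrite lee_fin sqr_ge0.
under eq_integral do rewrite -EFinM.
rewrite ge0_symfun_integralT; last 3 first.
- by move=> x; rewrite mulr_ge0 ?sqr_ge0 ?normal_pdf_ge0.
- move=> x; apply: cvgM; first exact: exprn_continuous.
  exact: continuous_normal_pdf.
- by move=> x; rewrite /= sqrrN symp.
rewrite -set_itvcy integral0y_sqr_normal_pdf// muleCA set_itvcy.
rewrite -ge0_symfun_integralT//; last 2 first.
- by move=> x; exact: normal_pdf_ge0.
- exact: continuous_normal_pdf.
by rewrite integral_normal_pdf mule1.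
Qed.
End normal_second_moment.

(** * Independence, product laws and products of expectations *)

Section independence.
Context {R : realType} {d d1 d2 : measure_display} {T : measurableType d}
  {T1 : measurableType d1} {T2 : measurableType d2} (P : probability T R).

(** Arbitrary measurable codomains allow [U] to be a pair of coordinates. *)
Definition independent_rv (U : T -> T1) (V : T -> T2) : Prop :=
  forall A B, measurable A -> measurable B ->
    P (U @^-1` A `&` V @^-1` B) = (P (U @^-1` A) * P (V @^-1` B))%E.

Local Open Scope ereal_scope.

(** Independence is agreement of the two laws on rectangles, and this determines the product
    measure. *)
Lemma independent_distribution_prod (U : {mfun T >-> T1}) (V : {mfun T >-> T2})
    (W : {mfun T >-> (T1 * T2)%type}) :
  W =1 (fun w => (U w, V w)) -> independent_rv U V ->
  forall A, measurable A ->
    distribution P W A = (distribution P U \x distribution P V) A.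
Proof.
move=> WE UV A mA; apply/esym/product_measure_unique => // B C mB mC.
rewrite -[RHS]UV// /distribution /pushforward; congr (P _).
by apply/seteqP; split => w /=; rewrite WE.
Qed.

Lemma independent_integralM (U : {mfun T >-> T1}) (V : {mfun T >-> T2})
    (f : T1 -> R) (g : T2 -> R) :
  independent_rv U V -> measurable_fun setT f -> measurable_fun setT g ->
  P.-integrable setT (fun w => (f (U w))%:E) ->
  P.-integrable setT (fun w => (g (V w))%:E) ->
  \int[P]_w (f (U w) * g (V w))%:E =
  (\int[P]_w (f (U w))%:E) * (\int[P]_w (g (V w))%:E).
Proof.
move=> UV mf mg intf intg.
have mUV : measurable_fun setT (fun w => (U w, V w)).
  exact/measurable_fun_pair.
pose W : {mfun T >-> (T1 * T2)%type} := HB.pack (fun w => (U w, V w))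
  (isMeasurableFun.Build _ _ _ _ _ mUV).
have prodE := @independent_distribution_prod U V W (fun=> erefl) UV.
pose h (z : T1 * T2) := (f z.1 * g z.2)%:E.
have mh : measurable_fun setT h.
  apply/measurable_EFinP.
  by apply: measurable_funM; apply: measurableT_comp.
have mfE : measurable_fun setT (EFin \o f) by exact/measurable_EFinP.
have mgE : measurable_fun setT (EFin \o g) by exact/measurable_EFinP.
have dU : (distribution P U).-integrable setT (EFin \o f).
  exact: integrable_pushforward.
have dV : (distribution P V).-integrable setT (EFin \o g).
  exact: integrable_pushforward.
(* By Tonelli, the integral of [|f| |g|] factors into two finite integrals. *)
have inthd : (distribution P U \x distribution P V).-integrable setT h.
  apply/integrable12ltyP => //=.
  under eq_integral.
    move=> x _; under eq_integral do rewrite normrM EFinM.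
    rewrite ge0_integralZl//; last by do 2 apply: measurableT_comp => //.
    over.
  move/integrableP : (dU) => [_ ?]; move/integrableP : (dV) => [_ ?].
  rewrite ge0_integralZr//.
  - apply: lte_mul_pinfty => //; [exact: integral_ge0|].
    by rewrite ge0_fin_numE//; exact: integral_ge0.
  - by do 2 apply: measurableT_comp => //.
  - exact: integral_ge0.
(* Integrability carries back to [T] because the law of [W] is the product law. *)
have inth : P.-integrable setT (h \o W).
  apply/integrableP; split; first exact: measurableT_comp.
  move/integrableP : inthd => [_].
  rewrite (@eq_measure_integral _ _ _ _ (distribution P W)); last first.
    by move=> A mA _; apply/esym; exact: prodE.
  by rewrite ge0_integral_distribution//; exact: measurableT_comp.
transitivity (\int[distribution P W]_z h z).
  by rewrite integral_distribution.
transitivity (\int[distribution P U \x distribution P V]_z h z).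
  by apply: eq_measure_integral => A mA _; exact: prodE.
rewrite -integral12_prod_meas1// /fubini_F /h/=.
rewrite -[X in _ = X * _](integral_distribution mfE)//.
rewrite -[X in _ = _ * X](integral_distribution mgE)//.
under eq_integral do rewrite (integralZl measurableT dV).
rewrite -(fineK (integrable_fin_num measurableT dV)).
by rewrite integralZr.
Qed.

(** For fixed [C], both sides are finite measures in [A]. They agree on rectangles, a generating
    family closed under intersection, hence everywhere. *)
Lemma independent_pair {d3 : measure_display} {T3 : measurableType d3}
    (U : {mfun T >-> T1}) (V : {mfun T >-> T2}) (Z : {mfun T >-> T3})
    (W : {mfun T >-> (T1 * T2)%type}) :
  W =1 (fun w => (U w, V w)) ->
  (forall A B C, measurable A -> measurable B -> measurable C ->
    P (U @^-1` A `&` V @^-1` B `&` Z @^-1` C) =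
    P (U @^-1` A `&` V @^-1` B) * P (Z @^-1` C)) ->
  forall A C, measurable A -> measurable C ->
    P (W @^-1` A `&` Z @^-1` C) = P (W @^-1` A) * P (Z @^-1` C).
Proof.
move=> WE UVZ A C mA mC.
have mZC : measurable (Z @^-1` C).
  by rewrite -[X in measurable X]setTI; exact: measurable_funPT.
have c0 : (0 <= fine (P (Z @^-1` C)))%R by rewrite fine_ge0.
pose m1 : {measure set (T1 * T2)%type -> \bar R} :=
  pushforward (mrestr P mZC) W.
pose m2 : {measure set (T1 * T2)%type -> \bar R} :=
  mscale (NngNum c0) (pushforward P W).
have mW : measurable_fun setT W by [].
suff : m1 mW A = m2 mW A.
  rewrite /m1 /m2 /= /mscale/= /pushforward /mrestr fineK ?fin_num_measure//.
  by rewrite muleC.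
pose G := [set A1 `*` A2 | A1 in @measurable _ T1 & A2 in @measurable _ T2].
apply: (measure_unique G (fun=> setT)) => //.
- exact: measurable_prod_measurableType.
- move=> _ _ [A1 mA1 [A2 mA2 <-]] [B1 mB1 [B2 mB2 <-]].
  exists (A1 `&` B1); first exact: measurableI.
  exists (A2 `&` B2); first exact: measurableI.
  by rewrite setXI.
- by move=> _; exists setT => //; exists setT => //; rewrite setXTT.
- by rewrite bigcup_const.
- move=> _ [A1 mA1 [A2 mA2 <-]].
  rewrite /m1 /m2 /= /mscale/= /pushforward /mrestr fineK ?fin_num_measure//.
  have -> : W @^-1` (A1 `*` A2) = U @^-1` A1 `&` V @^-1` A2.
    by apply/seteqP; split => w /=; rewrite WE.
  by rewrite UVZ// muleC.
- move=> _; rewrite /m1 /= /pushforward /mrestr preimage_setT setTI.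
  by rewrite -ge0_fin_numE// fin_num_measure.
Qed.
End independence.

(** * Factoring moments of two coordinates of [X] and of [e] *)

Section indep_moments.
Context {R : realType} {d : measure_display} {T : measurableType d}
  (P : probability T R) {n : nat} (X : T -> 'cV[R]_n) (e : T -> R).
Hypotheses (mX : forall i, measurable_fun setT (fun w => X w i 0))
  (me : measurable_fun setT e) (Xe : indep_vec_rv P X e).

Let X_ i w := X w i 0.

Let indep2 i j (A B C : set R) : measurable A -> measurable B -> measurable C ->
  (P (X_ i @^-1` A `&` X_ j @^-1` B `&` e @^-1` C) =
   P (X_ i @^-1` A `&` X_ j @^-1` B) * P (e @^-1` C))%E.
Proof.
move=> mA mB mC.
(* The intersection handles [i = j] too, where both constraints fall on one coordinate. *)
pose D k := (if k == i then A else setT) `&` (if k == j then B else setT).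
have mD k : measurable (D k) by apply: measurableI; case: ifP.
have -> : X_ i @^-1` A `&` X_ j @^-1` B =
    [set w | forall k, X w k ord0 \in D k].
  apply/seteqP; split => w /=.
    by move=> [XA XB] k; rewrite inE; split; case: eqP => // ->.
  move=> XD; split.
    by have := XD i; rewrite inE => -[]; rewrite eqxx.
  by have := XD j; rewrite inE => -[_]; rewrite eqxx.
exact: Xe.
Qed.

(** Two coordinates serve both uses: the covariance takes [f] to be the product, the mean takes
    [i = j] and an [f] that ignores its second argument. *)
Lemma indep_integral_comp2 i j (f : R -> R -> R) (g : R -> R) :
  measurable_fun setT (fun z : R * R => f z.1 z.2) -> measurable_fun setT g ->
  P.-integrable setT (fun w => (f (X w i 0) (X w j 0))%:E) ->
  P.-integrable setT (fun w => (g (e w))%:E) ->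
  (\int[P]_w (f (X w i 0) (X w j 0) * g (e w))%:E =
   (\int[P]_w (f (X w i 0) (X w j 0))%:E) * (\int[P]_w (g (e w))%:E))%E.
Proof.
move=> mf mg If Ig.
pose mk (Y : T -> R) (mY : measurable_fun setT Y) : {mfun T >-> R} :=
  HB.pack Y (isMeasurableFun.Build _ _ _ _ _ mY).
have mW : measurable_fun setT (fun w => (X w i 0, X w j 0)).
  exact/measurable_fun_pair.
pose W : {mfun T >-> (R * R)%type} := HB.pack (fun w => (X w i 0, X w j 0))
  (isMeasurableFun.Build _ _ _ _ _ mW).
apply: (@independent_integralM _ _ _ _ _ _ _ _ W (mk e me)
  (fun z : R * R => f z.1 z.2) g) => //.
apply: (@independent_pair _ _ _ _ _ _ _ _ _ _
  (mk _ (mX i)) (mk _ (mX j)) (mk e me) W) => //.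
exact: indep2.
Qed.
End indep_moments.

(** * Matrix preliminaries *)

Lemma posdef_unitmx {R : realType} {n : nat} (S : 'M[R]_n) :
  posdef S -> S \in unitmx.
Proof.
move=> [_ S0]; rewrite -row_free_unit; apply: inj_row_free => v vS.
(* A nonzero row [v] with [v *m S = 0] would make the quadratic form vanish at [v^T]. *)
apply/eqP/contraT => v0; have := S0 v^T; rewrite trmxK vS mul0mx mxE ltxx.
by apply; rewrite trmx_eq0.
Qed.

Lemma delta_quad {R : pzRingType} {n : nat} (S : 'M[R]_n) i j :
  ((delta_mx i (0 : 'I_1))^T *m S *m delta_mx j (0 : 'I_1)) 0 0 = S i j.
Proof. by rewrite trmx_delta -rowE -colE !mxE. Qed.

Lemma delta_lin {R : pzRingType} {n : nat} (x : 'cV[R]_n) i :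
  ((delta_mx i (0 : 'I_1))^T *m x) 0 0 = x i 0.
Proof. by rewrite trmx_delta -rowE mxE. Qed.

(** * First and second moments of a Gaussian vector *)

Section gaussian_moments.
Context {R : realType} {d : measure_display} {T : measurableType d}
  {P : probability T R} {n : nat} {X : T -> 'cV[R]_n} {S : 'M[R]_n}.
Hypotheses (Spd : posdef S) (XS : centered_gaussian P X S).

Let L (a : 'cV[R]_n) w : R := (a^T *m X w) 0 0.

Let measurable_L a : measurable_fun setT (L a).
Proof.
rewrite /L; under eq_fun do rewrite mxE.
by apply: measurable_sum => j; apply: measurable_funM => //; exact: XS.1.
Qed.

Lemma gaussian_sqr_moment (a : 'cV[R]_n) : a != 0 ->
  (\int[P]_w ((a^T *m X w) 0 0 ^+ 2)%:E = ((a^T *m S *m a) 0 0)%:E)%E.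
Proof.
move=> a0; have q0 := Spd.2 a a0.
have mL : measurable_fun setT (L a : T -> measurableTypeR R).
  exact: measurable_L.
pose La : {mfun T >-> measurableTypeR R} := HB.pack (L a)
  (isMeasurableFun.Build _ _ _ _ _ mL).
have msq : measurable_fun setT (fun x : measurableTypeR R => (x ^+ 2)%:E).
  exact/measurable_EFinP/measurable_funX.
transitivity (\int[distribution P La]_x (x ^+ 2)%:E)%E.
  by rewrite ge0_integral_distribution// => x; rewrite lee_fin sqr_ge0.
rewrite (@eq_measure_integral _ _ _ _
  (normal_prob 0 (Num.sqrt ((a^T *m S *m a) 0 0)))).
  by rewrite normal_prob_second_moment ?sqrtr_gt0// sqr_sqrtr// ltW.
move=> A mA _; have /= E := XS.2 a a0 A mA.
apply: etrans E; congr (P _).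
by apply/seteqP; split => w /=; rewrite inE.
Qed.

Let integrable_sqr a : a != 0 -> P.-integrable setT (fun w => (L a w ^+ 2)%:E).
Proof.
move=> a0; apply/integrableP; split.
  by apply/measurable_EFinP/measurable_funX.
under eq_integral do rewrite gee0_abs ?lee_fin ?sqr_ge0//.
by rewrite gaussian_sqr_moment// ltry.
Qed.

Let delta_neq0 i : delta_mx i 0 != 0 :> 'cV[R]_n.
Proof.
by apply/eqP => /matrixP/(_ i 0)/eqP; rewrite !mxE !eqxx oner_eq0.
Qed.

(** The law of [a^T X] is given only for [a != 0], so polarization needs this, also when [i = j]:
    the [i]-th entry is then 2, and otherwise 1. *)
Let deltaD_neq0 i j : delta_mx i 0 + delta_mx j 0 != 0 :> 'cV[R]_n.
Proof.
apply/eqP => /matrixP/(_ i 0)/eqP; rewrite !mxE !eqxx/= gt_eqF//.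
Qed.

Let polar i j w : X w i 0 * X w j 0 =
  2^-1 * (L (delta_mx i 0 + delta_mx j 0) w ^+ 2 -
   L (delta_mx i 0) w ^+ 2 - L (delta_mx j 0) w ^+ 2).
Proof.
rewrite /L linearD/= mulmxDl [in X in X ^+ 2 - _]mxE !delta_lin.
by field.
Qed.

Lemma integrable_gaussian_mul i j :
  P.-integrable setT (fun w => (X w i 0 * X w j 0)%:E).
Proof.
rewrite (_ : (fun w => _) = (fun w => (2^-1)%:E *
  ((L (delta_mx i 0 + delta_mx j 0) w ^+ 2)%:E -
   (L (delta_mx i 0) w ^+ 2)%:E - (L (delta_mx j 0) w ^+ 2)%:E))%E); last first.
  by apply/funext => w; rewrite polar.
apply: integrableZl => //.
by apply: integrableB => //; [apply: integrableB => //|]; exact: integrable_sqr.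
Qed.

Lemma gaussian_cov i j : (\int[P]_w (X w i 0 * X w j 0)%:E = (S i j)%:E)%E.
Proof.
transitivity (\int[P]_w ((2^-1)%:E *
  ((L (delta_mx i 0 + delta_mx j 0) w ^+ 2)%:E -
   (L (delta_mx i 0) w ^+ 2)%:E - (L (delta_mx j 0) w ^+ 2)%:E)))%E.
  by apply: eq_integral => w _; rewrite polar.
have I a : a != 0 -> P.-integrable setT (fun w => (L a w ^+ 2)%:E).
  exact: integrable_sqr.
rewrite integralZl//; last first.
  by apply: integrableB => //; [apply: integrableB => //|]; exact: I.
rewrite integralB//; [|by apply: integrableB => //; exact: I|exact: I].
rewrite integralB//; [|exact: I|exact: I].
rewrite !gaussian_sqr_moment// -!EFinB -EFinM; congr EFin.
have addE (A B : 'M[R]_1) : (A + B) 0 0 = A 0 0 + B 0 0 by rewrite mxE.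
rewrite [(_ + _)^T]linearD/= !mulmxDl !mulmxDr !addE !delta_quad.
(* Polarization yields the mean of [S i j] and [S j i]; symmetry merges them. *)
have -> : S j i = S i j by rewrite -[in LHS]Spd.1 mxE.
by field.
Qed.

Lemma integrable_gaussian i : P.-integrable setT (fun w => (X w i 0)%:E).
Proof.
apply: (@le_integrable _ _ _ _ _ _ _
  (fun w => (1 + X w i 0 * X w i 0)%:E)) => //.
- by apply/measurable_EFinP; exact: XS.1.
- move=> w _; rewrite !abse_EFin lee_fin.
  rewrite [leRHS]ger0_norm ?addr_ge0// -?expr2 ?sqr_ge0//.
  (* From [(|x| - 1)^2 >= 0] one gets [2 |x| <= 1 + x^2], so [1 + x^2] dominates [|x|]. *)
  have := sqr_ge0 (`|X w i 0| - 1); rewrite -[X in 1 + X]real_normK ?num_real//.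
  nra.
- apply: (integrableD measurableT (f := cst 1%E)
    (g := fun w => (X w i 0 * X w i 0)%:E)).
    exact: finite_measure_integrable_cst.
  exact: integrable_gaussian_mul.
Qed.
End gaussian_moments.

(** * Mahalanobis norm of the target gradient *)

Theorem theoremF10 (R : realType) (dsp : measure_display) (T : measurableType dsp)
  (P : probability T R) (n : nat) (hn : (0 < n)%N)
  (theta_star : 'cV[R]_n) (Sx : 'M[R]_n) (sig : R)
  (X : T -> 'cV[R]_n) (eps : T -> R)
  (xs : 'cV[R]_n) (ys : R) :
  posdef Sx -> 0 < sig ->
  centered_gaussian P X Sx ->
  measurable_fun setT eps ->
  indep_vec_rv P X eps ->
  P.-integrable setT (fun w => (eps w)%:E) ->
  (\int[P]_w (eps w)%:E = 0)%E ->
  (\int[P]_w ((eps w) ^+ 2)%:E = (sig ^+ 2)%:E)%E ->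
  let y := fun w => (theta_star^T *m X w) 0 0 + eps w in
  let G := fun theta : 'cV[R]_n => fun w =>
             grad (fun th => sqloss th (X w) (y w)) theta in
  let mu_g := fun theta => meanv P (G theta) in
  let Sigma_g := fun theta => covm P (G theta) in
  let eps_s := ys - (theta_star^T *m xs) 0 0 in
  let delta_g := grad (fun th => sqloss th xs ys) theta_star - mu_g theta_star in
  let m_star := (delta_g^T *m invmx (Sigma_g theta_star) *m delta_g) 0 0 in
  m_star = eps_s ^+ 2 / sig ^+ 2 * (xs^T *m invmx Sx *m xs) 0 0.
Proof.
move=> Spd sig_gt0 XS me Xe Ie Ee Ee2 y G mu_g Sigma_g eps_s delta_g m_star.
have sig0 : sig ^+ 2 != 0 by rewrite expf_neq0// gt_eqF.
have mX := XS.1.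
have GE w : G theta_star w = - eps w *: X w.
  by rewrite /G grad_sqloss /y addrAC subrr add0r.
have mu0 : mu_g theta_star = 0.
  apply/matrixP => i j; rewrite !mxE /Ex.
  under eq_integral do rewrite GE mxE mulrC.
  (* The factor [E[- eps] = 0] annihilates the mean, so the value of [E[x_i]] is never computed. *)
  rewrite (@indep_integral_comp2 _ _ _ P _ X eps mX me Xe i i (fun u _ => u) -%R)//.
  - under [X in (_ * X)%E]eq_integral do rewrite EFinN.
    by rewrite integralN//= ?Ee ?oppe0 ?mule0//; exact: integrable_add_def.
  - exact: measurable_fst.
  - exact: integrable_gaussian Spd XS i.
  - by under eq_fun do rewrite EFinN; exact: integrableN.
have SigmaE : Sigma_g theta_star = sig ^+ 2 *: Sx.
  apply/matrixP => i j; rewrite [LHS]mxE [RHS]mxE /Ex.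
  have mG k : meanv P (G theta_star) k 0 = 0.
    by rewrite -[meanv _ _]/(mu_g theta_star) mu0 mxE.
  (* With mean 0, the two signs of [- eps] cancel and the integrand separates into a function of [X]
     times [eps ^+ 2]. *)
  have -> : (\int[P]_w ((G theta_star w i 0 - meanv P (G theta_star) i 0) *
      (G theta_star w j 0 - meanv P (G theta_star) j 0))%:E =
      \int[P]_w ((X w i 0 * X w j 0) * eps w ^+ 2)%:E)%E.
    by apply: eq_integral => w _; rewrite !mG !subr0 GE !mxE; congr EFin; ring.
  rewrite (@indep_integral_comp2 _ _ _ P _ X eps mX me Xe i j *%R
    (fun u => u ^+ 2))//.
  - by rewrite (gaussian_cov Spd XS) Ee2 -EFinM/= mulrC.
  - exact: measurable_funM.
  - exact: integrable_gaussian_mul Spd XS i j.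
  - apply/integrableP; split; first exact/measurable_EFinP/measurable_funX.
    under eq_integral do rewrite gee0_abs ?lee_fin ?sqr_ge0//.
    by rewrite Ee2 ltry.
have deltaE : delta_g = - eps_s *: xs by rewrite /delta_g mu0 subr0 grad_sqloss.
have SgU : sig ^+ 2 *: Sx \in unitmx.
  by rewrite unitmxZ ?unitfE// posdef_unitmx.
(* All scalars are pulled out of the quadratic form: [(sig ^+ 2)^-1] from the inverse covariance and
   [- eps_s] from each side. *)
rewrite /m_star deltaE SigmaE invmxZ// [(_ *: xs)^T]linearZ/=.
rewrite !(=^~ scalemxAl, =^~ scalemxAr) !scalerA [LHS]mxE.
by congr (_ * _); rewrite mulrA mulrNN -expr2.
Qed.
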